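(* Let $-\infty\le a<b\le\infty$, let $\mu$ be a Borel measure with support in $(a,b)$, and let $K(r,x,\cdot)$ be a kernel depending on a parameter $r$. Suppose there are constants $M_1,M_2$ independent of $x$ and $r$ such that $$\int_a^b|K(r,x,y)|\,\mu(dy)\le M_1$$ and $$\int_x^b\mu(x,y)\,V_2(K(r,x,dy))\le M_2,\qquad \int_a^x\mu(y,x)\,V_2(K(r,x,dy))\le M_2 .$$ Then for every $f\in L^1(\mu)$, $$\left|\int_a^bK(r,x,y)f(y)\,\mu(dy)\right|\le M f^*_\mu(x),$$ where $M$ depends only on $M_1$ and $M_2$.
   Context: Here $\mu(x,y)$ denotes the $\mu$-measure of the interval $(x,y)$. $V_2(K(r,x,\cdot))$ is the (first) variation of the kernel in the variable $y$, i.e. $V_2(K(r,x,\cdot))=\sup\sum_i|K(r,x,y_i)-K(r,x,y_{i-1})|$ with supremum over all partitions, and $V_2(K(r,x,dy))$ is the corresponding variation measure; the integrals against it are Lebesgue–Stieltjes integrals. The non-centered Hardy–Littlewood maximal function of $f$ with respect to $\mu$ is $f^*_\mu(x)=\sup_{I\ni x}\frac{1}{\mu(I)}\int_I|f(y)|\,\mu(dy)$, the supremum being over intervals $I$ containing $x$.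
   Formalization: The weights μ(x,y), μ(y,x) are taken as measures of the closed intervals and the integrals against V_2(K(r,x,dy)) include the endpoint y=x; with open intervals the claim fails when μ has atoms, and for atomless μ the two versions coincide. *)

(* Defs.v *)
From HB Require Import structures.
From mathcomp Require Import all_boot all_order all_algebra.
From mathcomp Require Import all_classical all_reals all_analysis.
Set Implicit Arguments.
Unset Strict Implicit.
Unset Printing Implicit Defensive.
Import Order.TTheory GRing.Theory Num.Theory.
Import numFieldNormedType.Exports.
Local Open Scope classical_set_scope.
Local Open Scope ring_scope.
Local Open Scope ereal_scope.

Definition open_itv (R : realType) (a b : \bar R) : set R :=
  [set y : R | a < y%:E /\ y%:E < b].

Definition locally_bounded_variation (R : realType) (a b : \bar R)
    (k : R -> R) : Prop :=
  forall c d : R, a < c%:E -> d%:E < b -> bounded_variation c d k.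

Definition open_variation (R : realType) (c d : R) (k : R -> R) : \bar R :=
  ereal_sup [set v | exists s t : R,
    [/\ (c < s)%R, (s <= t)%R, (t < d)%R & v = total_variation s t k]].

(* The Lebesgue-Stieltjes variation measure of k on ]a, b[.  For k locally of
   bounded variation it exists and is unique on the Borel subsets of ]a, b[;
   with V a total variation function of k, nu `]c, d[ = V(d-) - V(c+), so that
   nu [set y] = V(y+) - V(y-) counts the jumps on both sides of y. *)
Definition is_variation_measure (R : realType) (a b : \bar R) (k : R -> R)
    (nu : {measure set (measurableTypeR R) -> \bar R}) : Prop :=
  locally_bounded_variation a b k /\
  forall c d : R, a < c%:E -> (c < d)%R -> d%:E < b ->
    nu `]c, d[%classic = open_variation c d k.

(* Since 0^-1 = +oo, +oo^-1 = 0 and +oo * 0 = 0 in \bar R, an interval of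
   measure 0 contributes 0, and so does one of infinite measure on which f is
   integrable. *)
Definition noncentered_maximal (R : realType)
    (mu : {measure set (measurableTypeR R) -> \bar R}) (f : R -> R) (x : R)
    : \bar R :=
  ereal_sup [set (mu [set` i])^-1 * \int[mu]_(y in [set` i]) `|(f y)%:E|
            | i in [set i : interval R | x \in i]].

(* Main.v *)
Require Import Defs.
From HB Require Import structures.
From mathcomp Require Import all_boot all_order all_algebra.
From mathcomp Require Import all_classical all_reals all_analysis.
From mathcomp Require Import measurable_realfun ring lra.
Set Implicit Arguments.
Unset Strict Implicit.
Unset Printing Implicit Defensive.
Import Order.TTheory GRing.Theory Num.Theory.
Import numFieldNormedType.Exports.
Local Open Scope classical_set_scope.
Local Open Scope ring_scope.
Local Open Scope ereal_scope.

(* On the right of x, for x <= y <= z, the kernel at y is at most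
   |K(z)| + nu [y, z].  Integrating this against |f| mu on [x, z], the first
   term gives |K(z)| times the integral of |f| over [x, z], at most
   A |K(z)| mu [x, z] with A the maximal function; the second, after Tonelli,
   is the integral over w in [x, z] of the integral of |f| over [x, w],
   at most A M2.  Since |K(z)| mu [x, z] <= 2 (M1 + M2), letting z tend to b
   bounds the right half by (2 M1 + 3 M2) A; the left half is symmetric.
   The measure mu need not be sigma-finite: Tonelli is only used on
   [x, z] with |f| >= 1/n, which has finite measure, and A is taken strictly
   above the maximal function, so that A > 0 and the bound by A mu(I) also
   holds when mu(I) = +oo. *)

(** * Tonelli and monotone convergence for arbitrary measures *)

(** Restricting [m1] to [A] and [m2] to [B] gives finite measures [n1] and [n2], to which
    [fubini_tonelli] applies; [h] is [g] cut off outside the rectangle. *)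
Lemma tonelli_finite_sets d1 d2 (T1 : measurableType d1)
    (T2 : measurableType d2) (R : realType)
    (m1 : {measure set T1 -> \bar R}) (m2 : {measure set T2 -> \bar R})
    (A : set T1) (B : set T2) (g : T1 * T2 -> \bar R) :
  measurable A -> measurable B -> m1 A < +oo -> m2 B < +oo ->
  measurable_fun [set: T1 * T2] g -> (forall p, 0 <= g p) ->
  measurable_fun setT (fun y => \int[m2]_(w in B) g (y, w)) /\
  \int[m1]_(y in A) \int[m2]_(w in B) g (y, w)
    = \int[m2]_(w in B) \int[m1]_(y in A) g (y, w).
Proof.
move=> mA mB Aoo Boo mg g0.
pose n1 : {finite_measure set T1 -> \bar R} := mfrestr mA Aoo.
pose n2 : {finite_measure set T2 -> \bar R} := mfrestr mB Boo.
pose h := g \_ (A `*` B).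
have mh : measurable_fun setT h.
  apply/(measurable_restrictT _ _).1; first exact: measurableX.
  exact: measurable_funTS.
have h0 p : 0 <= h p by apply: erestrict_ge0 => q _; exact: g0.
have i1 (u : T1 -> \bar R) : \int[m1]_(y in A) u y = \int[n1]_y (u \_ A) y.
  rewrite -integral_mkcond; apply: eq_measure_integral => C mC CA.
  by rewrite /n1 /= /mfrestr /mrestr setIidl.
have i2 (u : T2 -> \bar R) : \int[m2]_(y in B) u y = \int[n2]_y (u \_ B) y.
  rewrite -integral_mkcond; apply: eq_measure_integral => C mC CA.
  by rewrite /n2 /= /mfrestr /mrestr setIidl.
split.
  under eq_fun do rewrite i2.
  (* Only the second variable is cut off, so that measurability in [y] holds on the whole space. *)
  apply: (measurable_fun_fubini_tonelli_F (m2 := n2)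
    (fun p => ((fun w => g (p.1, w)) \_ B) p.2)).
    have -> : (fun p : T1 * T2 => ((fun w => g (p.1, w)) \_ B) p.2)
      = g \_ (setT `*` B).
      by apply/funext => -[y w]; rewrite /patch /= !in_setX in_setT.
    apply/(measurable_restrictT _ _).1; first exact: measurableX.
    exact: measurable_funTS.
  by move=> p; apply: erestrict_ge0 => q _; exact: g0.
transitivity (\int[n1]_y \int[n2]_w h (y, w)).
  rewrite i1; apply: eq_integral => y _; rewrite /patch; case: ifPn => yA.
    rewrite i2; apply: eq_integral => w _.
    by rewrite /patch /h /patch in_setX yA.
  rewrite integral0_eq// => w _.
  by rewrite /h /patch in_setX (negbTE yA).
rewrite fubini_tonelli// i2; apply: eq_integral => w _.
rewrite [in RHS]/patch; case: ifPn => wB.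
  rewrite i1; apply: eq_integral => y _.
  by rewrite /h /patch in_setX wB andbT.
rewrite integral0_eq// => y _.
by rewrite /h /patch in_setX (negbTE wB) andbF.
Qed.

Lemma ge0_integral_bigcup_le d (T : measurableType d) (R : realType)
    (m : {measure set T -> \bar R}) (F : (set T)^nat) (g : T -> \bar R)
    (C : \bar R) :
  nondecreasing_seq F -> (forall n, measurable (F n)) ->
  measurable_fun (\bigcup_n F n) g -> (forall y, 0 <= g y) ->
  (forall n, \int[m]_(y in F n) g y <= C) ->
  \int[m]_(y in \bigcup_n F n) g y <= C.
Proof.
move=> ndF mF mg g0 gC.
have mgF n : measurable_fun (F n) g by exact/(measurable_fun_bigcup _ mF).1.
have := ge0_nondecreasing_set_cvg_integral ndF mF mgF (mu := m)
  (fun i x _ => g0 x).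
move/cvg_lim => <- //; apply: lime_le; last exact: nearW.
apply: ereal_nondecreasing_is_cvgn.
exact: ge0_nondecreasing_set_nondecreasing_integral.
Qed.

(** * Exhaustion of intervals by oriented segments *)

(** If the supremum is attained, [u] is constant; if it is finite but not attained, [u n] is
    [sup J - 1/(n+1)], raised to [x] where needed to stay in [J]; if [J] is unbounded, [u n] is
    [x + n]. *)
Lemma is_interval_exhaustion (R : realType) (J : set R) (x : R) :
  is_interval J -> J x -> (forall y, J y -> (x <= y)%R) ->
  exists u : R^nat, [/\ forall n, J (u n), nondecreasing_seq u &
    forall y, J y -> exists n, (y <= u n)%R].
Proof.
move=> iJ Jx xJ; have [ubJ|nubJ] := pselect (has_ubound J).
  have sJ : has_sup J by split=> //; exists x.
  have leS y : J y -> (y <= sup J)%R by exact: ub_le_sup.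
  have [Js|nJs] := pselect (J (sup J)).
    exists (fun=> sup J); split=> // y /leS ?; by exists 0%N.
  pose u n := Num.max x (sup J - n.+1%:R^-1)%R.
  have ltS y : J y -> (y < sup J)%R.
    by move=> Jy; rewrite lt_neqAle leS// andbT; apply/eqP => yE;
      rewrite -yE in nJs.
  exists u; split.
  - move=> n; have : (u n < sup J)%R.
      by rewrite /u gt_max ltS// ltrBlDr ltrDl invr_gt0 ltr0Sn.
    move/(@sup_gt _ _ _)=> /(_ (ex_intro _ x Jx))[w Jw uw].
    by apply: (iJ x w) => //; rewrite (ltW uw) le_max lexx.
  - move=> m n mn; rewrite /u ge_max le_max lexx /= le_max; apply/orP; right.
    by rewrite lerD2l lerN2 lef_pV2 ?posrE ?ltr0Sn// ler_nat ltnS.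
  - move=> y /ltS/ltr_add_invr[k yk]; exists k.
    by rewrite /u le_max; apply/orP; right; rewrite lerBrDr ltW.
exists (fun n => x + n%:R)%R; split.
- move=> n; have [w [Jw nw]] : exists w, J w /\ (x + n%:R < w)%R.
    apply: contrapT => /forallNP H; apply: nubJ; exists (x + n%:R)%R => w Jw.
    by rewrite leNgt; apply/negP => ?; apply: (H w).
  by apply: (iJ x w) => //; rewrite lerDl ler0n ltW.
- by move=> m n mn; rewrite lerD2l ler_nat.
- move=> y Jy; exists (Num.bound `|y - x|%R).
  by rewrite -lerBlDl ltW// (le_lt_trans (ler_norm _))// archi_boundP.
Qed.

(* For s = 1 this is [y, z] and for s = -1 it is [z, y], so that both halves of
   the domain are handled at once. *)
Definition oseg (R : realDomainType) (s y z : R) : set R :=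
  [set w | (s * y <= s * w <= s * z)%R].

(** Reversing the order only swaps the two endpoints. This form lets convexity be used on [oseg]
    without a case split on the sign of [s]. *)
Lemma is_interval_scaled (R : realFieldType) (s : R) (J : set R) :
  s != 0%R -> is_interval J <->
  (forall u v, J u -> J v -> forall w, (s * u <= s * w <= s * v)%R -> J w).
Proof.
move=> s0; split=> iJ u v Ju Jv w.
  have [sn|sp] : (s < 0)%R \/ (0 < s)%R by apply/orP; rewrite -neq_lt.
    by rewrite !ler_nM2l// andbC; exact: iJ.
  by rewrite !ler_pM2l//; exact: iJ.
have [sn|sp] : (s < 0)%R \/ (0 < s)%R by apply/orP; rewrite -neq_lt.
  by move=> uwv; apply: (iJ v u) => //; rewrite !ler_nM2l// andbC.
by move=> uwv; apply: (iJ u v) => //; rewrite !ler_pM2l.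
Qed.

Lemma measurable_oseg (R : realType) (s y z : R) :
  s != 0%R -> measurable (oseg s y z : set (measurableTypeR R)).
Proof.
move=> s0; apply: is_interval_measurable; apply/(is_interval_scaled _ s0).
move=> u v; rewrite /oseg/= => /andP[yu _] /andP[_ vz] w /andP[uw wv].
by apply/andP; split; [exact: le_trans uw|exact: le_trans vz].
Qed.

(** Multiplication by [s] carries [J] to an interval [J'] with least element [s * x]; the sequence
    found there is pulled back. *)
Lemma oseg_exhaustion (R : realType) (s x : R) (J : set R) :
  s != 0%R -> is_interval J -> J x -> (forall y, J y -> (s * x <= s * y)%R) ->
  exists u : R^nat, [/\ forall n, J (u n),
    nondecreasing_seq (fun n => oseg s x (u n)) &
    J = \bigcup_n oseg s x (u n)].
Proof.
move=> s0 /(is_interval_scaled _ s0) iJ Jx xJ.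
pose J' := [set v | J (s^-1 * v)%R].
have iJ' : is_interval J'.
  move=> u v Ju Jv w uwv; apply: (iJ _ _ Ju Jv).
  by rewrite !mulVKf.
have J'x : J' (s * x)%R by rewrite /J' /= mulKf.
have J'ge y : J' y -> (s * x <= y)%R by move/xJ; rewrite mulVKf.
have [u [Ju ndu Jeu]] := is_interval_exhaustion iJ' J'x J'ge.
exists (fun n => s^-1 * u n)%R; split => //.
  move=> m n mn; apply/subsetPset => w; rewrite /oseg/= => /andP[xw wu].
  apply/andP; split=> //.
  by rewrite (le_trans wu)// !mulVKf// ndu.
apply/seteqP; split=> [y Jy|y [n _]].
  have [|n yn] := Jeu (s * y)%R; first by rewrite /J' /= mulKf.
  by exists n => //; apply/andP; split; rewrite ?xJ// mulVKf.
exact: (iJ _ _ Jx (Ju n)).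
Qed.

(** The function is monotone in [s * w], so its superlevel sets in [D] are traces of intervals; no
    finiteness of [mu] is involved. *)
Lemma measurable_fun_mu_oseg (R : realType)
    (mu : {measure set (measurableTypeR R) -> \bar R}) (s x : R) (D : set R) :
  s != 0%R -> measurable_fun (D : set (measurableTypeR R))
    (fun w => mu (oseg s x w)).
Proof.
move=> s0 mD.
apply: (measurability _ (ErealGenCInfty.measurableE R)) => //.
move=> /= _ [_ [a ->]] <-; apply: measurableI => //.
apply: is_interval_measurable; apply/(is_interval_scaled _ s0) => u v.
rewrite /= !in_itv/= !andbT => au av w /andP[uw wv]; rewrite in_itv/= andbT.
apply: le_trans au _; apply: le_measure; rewrite ?inE; [exact: measurable_oseg..|].
by move=> p; rewrite /oseg/= => /andP[-> pu]; exact: le_trans uw.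
Qed.

(** * The estimate on one side of [x] *)

(** Uniformity in [z] is what allows [z] to approach the end of [D] later on. The factor 2 comes
    from splitting at half the height [|k z|]. *)
Lemma kernel_endpoint_le (R : realType) (s x M1 M2 : R) (D : set R)
    (mu nu : {measure set (measurableTypeR R) -> \bar R}) (k : R -> R) :
  s != 0%R -> is_interval D -> D x -> (forall y, D y -> (s * x <= s * y)%R) ->
  measurable_fun (D : set (measurableTypeR R)) k ->
  (forall y z, D y -> D z -> (s * y <= s * z)%R ->
    `|k y - k z|%:E <= nu (oseg s y z)) ->
  \int[mu]_(y in D) `|k y|%:E <= M1%:E ->
  \int[nu]_(y in D) mu (oseg s x y) <= M2%:E ->
  forall z, D z -> `|k z|%:E * mu (oseg s x z) <= (2 * (M1 + M2))%:E.
Proof.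
move=> s0 iD Dx xD mk kvar kM1 nuM2 z Dz.
have mD : measurable (D : set (measurableTypeR R)).
  exact: is_interval_measurable.
have iDs := (is_interval_scaled _ s0).1 iD.
have segD y : D y -> oseg s x y `<=` D by move=> Dy w; exact: iDs.
have M10 : (0 <= M1)%R.
  by rewrite -lee_fin; apply: le_trans kM1; apply: integral_ge0.
have M20 : (0 <= M2)%R.
  by rewrite -lee_fin; apply: le_trans nuM2; apply: integral_ge0.
have [kz0|kz0] := eqVneq (k z) 0%R.
  by rewrite kz0 normr0 mul0e lee_fin mulr_ge0// addr_ge0.
(* Where nu [y, z] <= t the kernel is at least t, and Markov's inequality for
   |K| applies; the y with nu [y, z] > t form an initial segment J, every
   [x, y] in J having measure at most M2 / t. *)
pose t := (`|k z| / 2)%R.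
have t0 : (0 < t)%R by rewrite divr_gt0 ?normr_gt0.
pose J := [set y | oseg s x z y /\ t%:E < nu (oseg s y z)].
have Jini y w : J y -> (s * x <= s * w)%R -> (s * w <= s * y)%R -> J w.
  move=> [/andP[xy yz] ty] xw wy;
  split; first by apply/andP; split => //; exact: le_trans yz.
  apply: lt_le_trans ty _; apply: le_measure; rewrite ?inE; [exact: measurable_oseg..|].
  by move=> p; rewrite /oseg/= => /andP[yp ->]; rewrite (le_trans wy).
have iJ : is_interval J.
  apply/(is_interval_scaled _ s0) => u v [/andP[xu _] _] Jv w /andP[uw wv].
  by apply: (Jini v) => //; exact: le_trans uw.
have mJ : measurable (J : set (measurableTypeR R)).
  exact: is_interval_measurable.
have mseg y y' : measurable (oseg s y y' : set (measurableTypeR R)).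
  exact: measurable_oseg.
have muJ : t%:E * mu J <= M2%:E.
  have [->|/set0P[y0 Jy0]] := eqVneq J set0.
    by rewrite measure0 mule0 lee_fin.
  have Jx : J x.
    apply: (Jini y0) => //; by case: Jy0 => /andP[].
  have [u [Ju ndu JE]] :=
    oseg_exhaustion s0 iJ Jx (fun y Jy => proj1 (andP Jy.1)).
  rewrite -integral_cst// JE; apply: ge0_integral_bigcup_le => //.
    by move=> y; rewrite lee_fin ltW.
  move=> n; rewrite integral_cst//.
  have [/andP[xu uz] tu] := Ju n.
  (* For [y] in [[u n, z]] the segment [[x, y]] contains [[x, u n]], hence [t * mu [x, u n] <= mu
     [x, u n] * nu [u n, z]], which is at most the integral of [mu [x, y]] against [nu] over
     [[u n, z]]. *)
  apply: (@le_trans _ _ (mu (oseg s x (u n)) * nu (oseg s (u n) z))).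
    by rewrite muleC lee_wpmul2l// ltW.
  rewrite -integral_cst//; apply: le_trans nuM2.
  apply: (@le_trans _ _ (\int[nu]_(y in oseg s (u n) z) mu (oseg s x y))).
    apply: ge0_le_integral => //; first exact: measurable_fun_mu_oseg.
    move=> y /andP[uy yz]; apply: le_measure; rewrite ?inE//.
    by move=> p; rewrite /oseg/= => /andP[-> pu]; exact: le_trans uy.
  apply: ge0_subset_integral => //; first exact: measurable_fun_mu_oseg.
  move=> y /andP[uy yz]; apply: (segD z) => //; apply/andP; split=> //.
  exact: le_trans uy.
have muJC : t%:E * mu (oseg s x z `\` J) <= M1%:E.
  rewrite -integral_cst; last exact: measurableD.
  have CD : oseg s x z `\` J `<=` D by move=> y [yz _]; exact: segD yz.
  have mak : measurable_fun (D : set (measurableTypeR R)) (fun y => `|k y|%:E).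
    by apply/measurable_EFinP; exact: measurableT_comp.
  apply: le_trans kM1.
  apply: (@le_trans _ _ (\int[mu]_(y in oseg s x z `\` J) `|k y|%:E)).
    apply: ge0_le_integral => //.
    - exact: measurableD.
    - by move=> *; rewrite lee_fin ltW.
    - exact: measurable_funS mak.
    move=> y [yz nJy]; have Dy : D y by exact: segD yz.
    have : nu (oseg s y z) <= t%:E.
      by rewrite leNgt; apply/negP => ty; apply: nJy.
    move=> /(le_trans (kvar y z Dy Dz _)); have /andP[_ yz'] := yz.
    move=> /(_ yz'); rewrite !lee_fin => kyz.
    have := ler_normD (k z - k y)%R (k y); rewrite subrK distrC.
    by move: kyz; rewrite /t; lra.
  by apply: ge0_subset_integral => //; exact: measurableD.
have muE : mu (oseg s x z) <= mu J + mu (oseg s x z `\` J).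
  rewrite -measureU//; [|exact: measurableD|by rewrite setDIK].
  apply: le_measure; rewrite ?inE//; last by rewrite setDUK// => y [].
  by apply: measurableU => //; exact: measurableD.
rewrite (_ : `|k z| = 2 * t)%R; last by rewrite /t mulrC divfK.
rewrite !EFinM -muleA lee_wpmul2l// ?lee_fin//.
apply: (@le_trans _ _ (t%:E * (mu J + mu (oseg s x z `\` J)))).
  by rewrite lee_wpmul2l// lee_fin ltW.
by rewrite ge0_muleDr// EFinD addeC leeD.
Qed.

(** Write [nu [y, z]] as the [nu]-integral over [w] of the indicator of [y <= w] (in the order given
    by [s]) and exchange: the inner integral becomes that of [|f|] over the part of [F] in [[x, w]],
    where [fA] applies. *)
Lemma variation_tonelli (R : realType) (s x z A : R)
    (mu nu : {measure set (measurableTypeR R) -> \bar R}) (f : R -> R)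
    (F : set R) :
  s != 0%R -> (0 <= A)%R ->
  measurable_fun (setT : set (measurableTypeR R)) f ->
  (forall w, oseg s x z w ->
    \int[mu]_(y in oseg s x w) `|f y|%:E <= A%:E * mu (oseg s x w)) ->
  measurable (F : set (measurableTypeR R)) -> F `<=` oseg s x z ->
  mu F < +oo -> nu (oseg s x z) < +oo ->
  measurable_fun (F : set (measurableTypeR R))
    (fun y => `|f y|%:E * nu (oseg s y z)) /\
  \int[mu]_(y in F) (`|f y|%:E * nu (oseg s y z))
    <= A%:E * \int[nu]_(w in oseg s x z) mu (oseg s x w).
Proof.
move=> s0 A0 mf fA mF Fz muF nuz.
pose mR : measurableType _ := measurableTypeR R.
have mseg y y' : measurable (oseg s y y' : set mR) by exact: measurable_oseg.
pose E := [set p : mR * mR | (s * p.1 <= s * p.2)%R].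
have mE : measurable E.
  rewrite -[E]setTI; apply: measurable_fun_le => //.
    by apply: measurable_funM => //; exact: measurable_fst.
  by apply: measurable_funM => //; exact: measurable_snd.
pose g (p : mR * mR) := (`|f p.1| * \1_E p)%:E.
have mg : measurable_fun [set: mR * mR] g.
  apply/measurable_EFinP; apply: measurable_funM; last exact: measurable_indic.
  apply: measurableT_comp => //; apply: (measurableT_comp mf).
  exact: measurable_fst.
have g0 p : 0 <= g p by rewrite lee_fin mulr_ge0.
have maf : measurable_fun (setT : set mR) (fun y => `|f y|%:E).
  by apply/measurable_EFinP; exact: measurableT_comp.
have [mI IE] := tonelli_finite_sets mF (mseg x z) muF nuz mg g0.
have gE y : F y ->
    \int[nu]_(w in oseg s x z) g (y, w) = `|f y|%:E * nu (oseg s y z).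
  move=> Fy; have /andP[xy yz] := Fz _ Fy.
  transitivity (\int[nu]_(w in oseg s x z)
      (`|f y|%:E * (\1_(oseg s y z) w)%:E)).
    apply: eq_integral => w; rewrite inE => /andP[xw wz].
    rewrite /g/= EFinM; congr (_ * (_%:R)%:E).
    by congr nat_of_bool; apply/idP/idP; rewrite !inE /E /oseg /= wz andbT.
  rewrite ge0_integralZl_EFin//; last first.
    by apply/measurable_EFinP; exact: measurable_indic.
  rewrite integral_indic// setIidl// => w; rewrite /oseg/= => /andP[yw ->].
  by rewrite (le_trans xy yw).
split.
  apply: (eq_measurable_fun (fun y => \int[nu]_(w in oseg s x z) g (y, w))).
    by move=> y; rewrite inE => /gE ->.
  exact: measurable_funTS.
rewrite (eq_integral (fun y => \int[nu]_(w in oseg s x z) g (y, w))); last first.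
  by move=> y; rewrite inE => /gE ->.
rewrite IE -ge0_integralZl_EFin//; last exact: measurable_fun_mu_oseg.
apply: ge0_le_integral => //.
- by move=> w _; apply: integral_ge0.
(* Measurability in [w] of the inner integral is the first half of [tonelli_finite_sets] with the
   two variables exchanged. *)
- have mg' : measurable_fun [set: mR * mR] (fun p => g (p.2, p.1)).
    apply: (measurableT_comp mg); apply/measurable_fun_pairP; split.
      exact: measurable_snd.
    exact: measurable_fst.
  have [mI' _] := tonelli_finite_sets (mseg x z) mF nuz muF mg' (fun p => g0 _).
  exact: measurable_funTS mI'.
- by apply: measurable_funeM; exact: measurable_fun_mu_oseg.
move=> w xwz; apply: le_trans (fA w xwz).
rewrite [leLHS](_ : _ = \int[mu]_(y in F `&` oseg s x w) `|f y|%:E).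
  apply: ge0_subset_integral => //; first exact: measurableI.
  exact: measurable_funTS.
rewrite integral_mkcondr; apply: eq_integral => y; rewrite inE => Fy.
have /andP[xy yz] := Fz _ Fy.
rewrite /patch /g /= indicE; case: ifPn.
  rewrite inE /oseg /= => /andP[_ yw].
  by rewrite mem_set// mulr1.
rewrite notin_setE /oseg/= xy /= => yw.
by rewrite memNset// mulr0.
Qed.

Lemma one_sided_maximal_bound (R : realType) (s x M1 M2 A : R) (D : set R)
    (mu nu : {measure set (measurableTypeR R) -> \bar R}) (k f : R -> R) :
  s != 0%R -> is_interval D -> D x -> (forall y, D y -> (s * x <= s * y)%R) ->
  measurable_fun (D : set (measurableTypeR R)) k ->
  (forall y z, D y -> D z -> (s * y <= s * z)%R ->
    `|k y - k z|%:E <= nu (oseg s y z)) ->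
  (forall z, D z -> nu (oseg s x z) < +oo) ->
  \int[mu]_(y in D) `|k y|%:E <= M1%:E ->
  \int[nu]_(y in D) mu (oseg s x y) <= M2%:E ->
  mu.-integrable setT (EFin \o f) -> (0 <= A)%R ->
  (forall z, D z ->
    \int[mu]_(y in oseg s x z) `|f y|%:E <= A%:E * mu (oseg s x z)) ->
  \int[mu]_(y in D) `|k y * f y|%:E <= ((2 * M1 + 3 * M2) * A)%:E.
Proof.
move=> s0 iD Dx xD mk kvar nuD kM1 nuM2 intf A0 fA.
have [/measurable_EFinP mf foo] := integrableP _ _ _ intf.
have iDs := (is_interval_scaled _ s0).1 iD.
have mD : measurable (D : set (measurableTypeR R)).
  exact: is_interval_measurable.
have mseg y y' : measurable (oseg s y y' : set (measurableTypeR R)).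
  exact: measurable_oseg.
have segD y : D y -> oseg s x y `<=` D by move=> Dy w; exact: iDs.
have maf (B : set R) :
    measurable_fun (B : set (measurableTypeR R)) (fun y => `|f y|%:E).
  by apply/measurable_EFinP; exact/measurable_funTS/measurableT_comp.
have mkf : measurable_fun (D : set (measurableTypeR R))
    (fun y => `|k y * f y|%:E).
  apply/measurable_EFinP; apply: measurableT_comp => //.
  by apply: measurable_funM => //; exact: measurable_funTS.
have step z (F : set R) : D z -> measurable (F : set (measurableTypeR R)) ->
    F `<=` oseg s x z -> mu F < +oo ->
    \int[mu]_(y in F) `|k y * f y|%:E <= ((2 * M1 + 3 * M2) * A)%:E.
  move=> Dz mF Fz muF.
  have fAz w : oseg s x z w ->
      \int[mu]_(y in oseg s x w) `|f y|%:E <= A%:E * mu (oseg s x w).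
    by move=> xwz; apply: fA; exact: segD xwz.
  have [mI IF] := variation_tonelli s0 A0 mf fAz mF Fz muF (nuD _ Dz).
  apply: (@le_trans _ _ (\int[mu]_(y in F)
      (`|k z|%:E * `|f y|%:E + `|f y|%:E * nu (oseg s y z)))).
    apply: ge0_le_integral => //.
    - by apply: measurable_funS mkf => // y /Fz; exact: segD.
    - apply: emeasurable_funD => //; exact: measurable_funeM.
    move=> y Fy; have /andP[xy yz] := Fz _ Fy.
    rewrite normrM mulrC EFinM [`|k z|%:E * _]muleC -ge0_muleDr//.
    rewrite lee_wpmul2l//.
    apply: (@le_trans _ _ (`|k z|%:E + `|k y - k z|%:E)).
      by rewrite -EFinD lee_fin -[in leLHS](subrKC (k z) (k y)) ler_normD.
    by rewrite leeD2l// kvar//; exact/(segD _ Dz)/Fz.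
  rewrite ge0_integralD//; last exact: measurable_funeM.
  rewrite ge0_integralZl//.
  (* The first summand pays for the endpoint term [|k z| * mu [x, z]], the second for the variation
     term. *)
  have -> : ((2 * M1 + 3 * M2) * A = A * (2 * (M1 + M2)) + A * M2)%R by ring.
  rewrite EFinD leeD//.
    apply: (@le_trans _ _ (`|k z|%:E * (A%:E * mu (oseg s x z)))).
      rewrite lee_wpmul2l//; apply: le_trans (fA z Dz).
      exact: ge0_subset_integral.
    rewrite muleCA EFinM lee_wpmul2l ?lee_fin//.
    exact: (kernel_endpoint_le s0 iD Dx xD mk kvar kM1 nuM2).
  apply: (le_trans IF); rewrite EFinM lee_wpmul2l ?lee_fin//.
  apply: le_trans nuM2; apply: ge0_subset_integral => //; last exact: segD.
  exact: measurable_fun_mu_oseg.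
have [u [Du ndu DE]] := oseg_exhaustion s0 iD Dx xD.
(* The union of the [F n] misses only the zeros of [f] in [D], where the integrand vanishes. *)
pose F n := oseg s x (u n) `&` [set y | (n.+1%:R^-1 <= `|f y|)%R].
have mF n : measurable (F n : set (measurableTypeR R)).
  apply: (@measurable_fun_le _ (measurableTypeR R)) => //.
  by apply: measurableT_comp => //; exact: measurable_funTS.
have FD : \bigcup_n F n `<=` D by move=> y [n _ [yu _]]; exact: segD yu.
rewrite (_ : integral _ _ _ =
    \int[mu]_(y in \bigcup_n F n) `|k y * f y|%:E); last first.
  rewrite integral_mkcond [RHS]integral_mkcond; apply: eq_integral => y _.
  rewrite /patch; case: ifPn => [|nDy]; last first.
    by case: ifPn => // /set_mem/FD/mem_set; rewrite (negbTE nDy).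
  rewrite inE => Dy; case: ifPn => //; rewrite notin_setE => nF.
  have [->|fy0] := eqVneq (f y) 0%R; first by rewrite mulr0 normr0.
  exfalso; apply: nF; move: Dy; rewrite DE => -[n _ yn].
  have [|m] := @ltr_add_invr R 0%R `|f y|%R; first by rewrite normr_gt0.
  rewrite add0r => fm; exists (maxn n m) => //; split.
    have := ndu _ _ (leq_maxl n m); move/subsetPset; exact.
  rewrite /=; apply: le_trans (ltW fm).
  by rewrite lef_pV2 ?posrE ?ltr0Sn// ler_nat ltnS leq_maxr.
apply: ge0_integral_bigcup_le => //.
- move=> m n mn; apply/subsetPset => y [yu fy]; split.
    have := ndu _ _ mn; move/subsetPset; exact.
  rewrite /=; apply: le_trans fy.
  by rewrite lef_pV2 ?posrE ?ltr0Sn// ler_nat ltnS.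
- exact: measurable_funS mkf.
move=> n; apply: (step (u n)) => //; first by move=> y [].
(* Markov's inequality: [|f| >= 1/(n+1)] on [F n] and [f] is integrable. *)
have : n.+1%:R^-1%:E * mu (F n) < +oo.
  apply: le_lt_trans foo; rewrite -integral_cst//.
  apply: (@le_trans _ _ (\int[mu]_(y in F n) `|f y|%:E)).
    by apply: ge0_le_integral => // y [_]; rewrite lee_fin.
  by apply: ge0_subset_integral => //; exact: maf.
apply: contraTT; rewrite -!leNgt !leye_eq => /eqP ->.
by rewrite gt0_muley// lte_fin.
Qed.

(** * Variation measures of closed intervals and measurability of the kernel *)

Lemma open_itv_margin (R : realType) (a b : \bar R) (y z : R) :
  a < y%:E -> z%:E < b ->
  exists2 e : R, (0 < e)%R & a < (y - e)%:E /\ (z + e)%:E < b.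
Proof.
move=> ay zb.
have [e1 e10 ae1] : exists2 e : R, (0 < e)%R & a < (y - e)%:E.
  case: a ay => [a|//|] ay; last by exists 1%R => //; rewrite ltNyr.
  by exists ((y - a) / 2)%R; move: ay; rewrite !lte_fin => ay; lra.
have [e2 e20 be2] : exists2 e : R, (0 < e)%R & (z + e)%:E < b.
  case: b zb => [b||//] zb; last by exists 1%R => //; rewrite ltry.
  by exists ((b - z) / 2)%R; move: zb; rewrite !lte_fin => zb; lra.
exists (Num.min e1 e2); first by rewrite lt_min e10.
split; [apply: lt_le_trans ae1 _|apply: le_lt_trans be2]; rewrite lee_fin.
  by rewrite lerD2l lerN2 ge_min lexx.
by rewrite lerD2l ge_min lexx orbT.
Qed.

(** The value of [nu] is prescribed on open intervals only, so [[y, z]] is reached by continuity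
    from above along the shrinking intervals [F n]. The first inequality can be strict: [nu] also
    counts the outer jumps of [k] at [y] and [z]. *)
Lemma variation_measure_itvcc (R : realType) (a b : \bar R) (k : R -> R)
    (nu : {measure set (measurableTypeR R) -> \bar R}) (y z : R) :
  is_variation_measure a b k nu -> a < y%:E -> (y <= z)%R -> z%:E < b ->
  total_variation y z k <= nu `[y, z]%classic /\ nu `[y, z]%classic < +oo.
Proof.
move=> [bvk nuE] ay yz zb.
have [e e0 [ae be]] := open_itv_margin ay zb.
pose c n := (y - e / n.+1%:R)%R; pose d n := (z + e / n.+1%:R)%R.
have en0 n : (0 < e / n.+1%:R)%R by rewrite divr_gt0.
have ene n : (e / n.+1%:R <= e)%R by rewrite ler_pdivrMr// ler_peMr ?ler1n// ltW.
have cy n : (c n < y)%R by rewrite ltrBlDr ltrDl.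
have zd n : (z < d n)%R by rewrite ltrDl.
have ac n : a < (c n)%:E by apply: lt_le_trans ae _; rewrite lee_fin lerD2l lerN2.
have db n : (d n)%:E < b by apply: le_lt_trans be; rewrite lee_fin lerD2l.
have cd n : (c n < d n)%R by rewrite (lt_trans (cy n))// (le_lt_trans yz).
pose F n : set R := `]c n, d n[%classic.
have F0oo : nu (F 0%N) < +oo.
  (* Continuity from above needs one finite measure: the open variation is at most the total
     variation on the closed interval, which still lies in []a, b[] by the choice of [e]. *)
  rewrite nuE//; apply: (@le_lt_trans _ _ (total_variation (c 0%N) (d 0%N) k)).
    apply: ge_ereal_sup => _ [s [t [cs st td ->]]].
    rewrite (total_variationD k (ltW cs)); last exact: (le_trans st (ltW td)).
    rewrite (total_variationD k st (ltW td)) addeCA leeDl// adde_ge0//.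
      by apply: total_variation_ge0; exact: ltW.
    by apply: total_variation_ge0; exact: ltW.
  rewrite -ge0_fin_numE; last by apply: total_variation_ge0; exact: ltW.
  by apply/bounded_variationP; [exact: ltW|exact: bvk].
have yzF n : `[y, z]%classic `<=` F n.
  move=> w; rewrite /F /= !in_itv/= => /andP[yw wz].
  by rewrite (lt_le_trans (cy n) yw) (le_lt_trans wz).
have FE : \bigcap_n F n = `[y, z]%classic.
  apply/seteqP; split=> [w Fw|w yzw n _]; last exact: yzF.
  rewrite /= in_itv/=; apply/andP; split; rewrite leNgt; apply/negP => h.
    have /ltr_add_invr[m] : (0 < (y - w) / e)%R by rewrite divr_gt0// subr_gt0.
    rewrite add0r ltr_pdivlMr// mulrC => mw.
    have := Fw m Logic.I; rewrite /F /= in_itv/= => /andP[cw _].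
    by move: cw; rewrite /c ltrBlDr -ltrBlDl ltNge (ltW mw).
  have /ltr_add_invr[m] : (0 < (w - z) / e)%R by rewrite divr_gt0// subr_gt0.
  rewrite add0r ltr_pdivlMr// mulrC => mw.
  have := Fw m Logic.I; rewrite /F /= in_itv/= => /andP[_ wd].
  by move: wd; rewrite /d -ltrBlDl ltNge (ltW mw).
split.
  have mF n : measurable (F n : set (measurableTypeR R)) by exact: measurable_itv.
  have cvgF : nu \o F @ \oo --> nu (\bigcap_n F n).
    apply: nonincreasing_cvg_mu => //; first by rewrite FE; exact: measurable_itv.
    move=> m n mn; apply/subsetPset => w; rewrite /F /= !in_itv/= => /andP[cw wd].
    have enm : (e / n.+1%:R <= e / m.+1%:R)%R.
      by rewrite ler_pM2l// lef_pV2 ?posrE ?ltr0Sn// ler_nat ltnS.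
    by rewrite (le_lt_trans _ cw) ?(lt_le_trans wd)// /c /d lerD2l ?lerN2.
  rewrite -FE -(cvg_lim _ cvgF)//; apply: lime_ge.
    by apply/cvg_ex; exists (nu (\bigcap_n F n)).
  apply: nearW => n; rewrite /= nuE//; apply: ereal_sup_ubound.
  by exists y, z.
apply: le_lt_trans F0oo; apply: le_measure; rewrite ?inE//; exact: measurable_itv.
Qed.

Lemma nondecreasing_in_measurable (R : realType) (c d : R) (h : R -> R) :
  {in `[c, d] &, nondecreasing_fun h} ->
  measurable_fun (`[c, d]%classic : set (measurableTypeR R)) h.
Proof.
move=> ndh; have [cd|dc] := leP c d; last first.
  by rewrite set_itv_ge -?leNgt ?bnd_simp ?leNgt// ; exact: measurable_fun_set0.
(* Clamping the argument to [[c, d]] makes [h] nondecreasing on the whole line. *)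
apply: (eq_measurable_fun (fun w => h (Num.max c (Num.min d w)))).
  move=> w; rewrite inE/= in_itv/= => /andP[cw wd].
  by rewrite (min_r wd) (max_r cw).
apply: nondecreasing_measurable => [|u v uv]; first exact: measurable_itv.
have m w : Num.max c (Num.min d w) \in `[c, d].
  by rewrite in_itv/= le_max lexx/= ge_max cd ge_min lexx.
apply: ndh => //; rewrite ge_max le_max lexx/= le_max; apply/orP; right.
by rewrite le_min ge_min lexx/= ge_min uv orbT.
Qed.

(** By the Jordan decomposition, [k] is a difference of two nondecreasing functions. *)
Lemma bounded_variation_measurable (R : realType) (c d : R) (k : R -> R) :
  bounded_variation c d k ->
  measurable_fun (`[c, d]%classic : set (measurableTypeR R)) k.
Proof.
move=> bvk.
apply: (eq_measurable_fun ((fine \o pos_tv c k) \- (fine \o neg_tv c k))%R).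
  move=> w; rewrite inE/= => wcd.
  by rewrite (bounded_variation_pos_neg_tvE bvk wcd).
apply: measurable_funB; apply: nondecreasing_in_measurable.
  exact/fine_neg_tv_nondecreasing/bounded_variationN.
exact: fine_neg_tv_nondecreasing.
Qed.

Lemma oseg_itv (R : realType) (s y z : R) : s != 0%R -> (s * y <= s * z)%R ->
  oseg s y z = `[Num.min y z, Num.max y z]%classic.
Proof.
move=> s0; have [sn|sp] : (s < 0)%R \/ (0 < s)%R by apply/orP; rewrite -neq_lt.
  rewrite ler_nM2l// => zy; rewrite (min_r zy) (max_l zy).
  by apply/seteqP; split=> w; rewrite /oseg/= in_itv/= !ler_nM2l// andbC.
rewrite ler_pM2l// => yz; rewrite (min_l yz) (max_r yz).
by apply/seteqP; split=> w; rewrite /oseg/= in_itv/= !ler_pM2l.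
Qed.

Lemma is_interval_open_itv (R : realType) (a b : \bar R) :
  is_interval (open_itv a b).
Proof.
move=> u v [au _] [_ vb] w /andP[uw wv]; split.
  by apply: lt_le_trans au _; rewrite lee_fin.
by apply: le_lt_trans vb; rewrite lee_fin.
Qed.

Lemma open_itv_minmax (R : realType) (a b : \bar R) (y z : R) :
  open_itv a b y -> open_itv a b z ->
  a < (Num.min y z)%:E /\ (Num.max y z)%:E < b.
Proof. by move=> [? ?] [? ?]; split; case: (leP y z). Qed.

Lemma open_itv_split (R : realType) (a b : \bar R) (x : R) : open_itv a b x ->
  open_itv a b = [set y | (x <= y)%R /\ y%:E < b] `|`
                 [set y | a < y%:E /\ (y <= x)%R].
Proof.
move=> [ax xb]; apply/seteqP; split=> [y [ay yb]|y [[xy yb]|[ay yx]]].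
- by case: (leP x y) => [|/ltW] xy; [left|right].
- by split=> //; apply: lt_le_trans ax _; rewrite lee_fin.
- by split=> //; apply: le_lt_trans xb; rewrite lee_fin.
Qed.

(** Each half of []a, b[] on either side of a point is a countable union of closed bounded intervals
    on which [k] has bounded variation. *)
Lemma locally_bounded_variation_measurable (R : realType) (a b : \bar R)
    (k : R -> R) :
  locally_bounded_variation a b k ->
  measurable_fun (open_itv a b : set (measurableTypeR R)) k.
Proof.
move=> bvk; have [->|/set0P[x abx]] := eqVneq (open_itv a b) set0.
  exact: measurable_fun_set0.
have half s (D : set R) : s != 0%R -> is_interval D -> D x ->
    D `<=` open_itv a b -> (forall y, D y -> (s * x <= s * y)%R) ->
    measurable_fun (D : set (measurableTypeR R)) k.
  move=> s0 iD Dx Dab xD.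
  have [u [Du _ ->]] := oseg_exhaustion s0 iD Dx xD.
  apply/measurable_fun_bigcup => n; first exact: measurable_oseg.
  rewrite oseg_itv ?xD//; apply: bounded_variation_measurable.
  have [? ?] := open_itv_minmax abx (Dab _ (Du n)).
  exact: bvk.
have E := open_itv_split abx; have [ax xb] := abx; rewrite E.
have iR : is_interval [set y | (x <= y)%R /\ y%:E < b].
  move=> u v [xu _] [_ vb] w /andP[uw wv]; split; first exact: le_trans uw.
  by apply: le_lt_trans vb; rewrite lee_fin.
have iL : is_interval [set y | a < y%:E /\ (y <= x)%R].
  move=> u v [au _] [_ vx] w /andP[uw wv]; split; last exact: le_trans vx.
  by apply: lt_le_trans au _; rewrite lee_fin.
apply/measurable_funU; [exact: is_interval_measurable..|split].
  apply: (half 1%R) => //; first by rewrite E; left.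
  by move=> y [xy _]; rewrite !mul1r.
apply: (half (-1)%R) => //; first by rewrite E; right.
by move=> y [_ yx]; rewrite !mulN1r lerN2.
Qed.

(** * The maximal function and the assembly of the two halves *)

Lemma noncentered_maximal_ge0 (R : realType)
    (mu : {measure set (measurableTypeR R) -> \bar R}) (f : R -> R) (x : R) :
  0 <= noncentered_maximal mu f x.
Proof.
apply: (@le_trans _ _ ((mu [set` `[x, x]])^-1 *
    \int[mu]_(y in [set` `[x, x]]) `|(f y)%:E|)).
  by rewrite mule_ge0 ?inve_ge0 ?integral_ge0.
by apply: ereal_sup_ubound; exists `[x, x] => //=; rewrite in_itv/= lexx.
Qed.

(** If [mu] is 0 on the interval, both sides vanish; if it is [+oo], so is the right side because
    [A > 0]; otherwise the average occurring in the supremum can be multiplied out. *)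
Lemma integral_le_maximal (R : realType)
    (mu : {measure set (measurableTypeR R) -> \bar R}) (f : R -> R) (x A : R)
    (i : interval R) :
  mu.-integrable setT (EFin \o f) -> noncentered_maximal mu f x < A%:E ->
  x \in i -> \int[mu]_(y in [set` i]) `|f y|%:E <= A%:E * mu [set` i].
Proof.
move=> intf fA xi.
have A0 : (0 < A)%R.
  by rewrite -lte_fin; apply: le_lt_trans fA; exact: noncentered_maximal_ge0.
have [/measurable_EFinP mf foo] := integrableP _ _ _ intf.
have mi : measurable ([set` i] : set (measurableTypeR R)) by exact: measurable_itv.
have [mu0|mu0] := eqVneq (mu [set` i]) 0.
  have mfi : measurable_fun ([set` i] : set (measurableTypeR R)) (EFin \o f).
    by apply/measurable_EFinP; exact: measurable_funTS.
  have /eqP := integral_abs_eq0 mi mfi mu0.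
  by rewrite mu0 mule0 eq_le => /andP[].
have [->|muoo] := eqVneq (mu [set` i]) +oo.
  by rewrite gt0_muley ?leey ?lte_fin.
have muf : mu [set` i] \is a fin_num by rewrite ge0_fin_numE// ltey.
have : (mu [set` i])^-1 * \int[mu]_(y in [set` i]) `|(f y)%:E| <= A%:E.
  by apply/(le_trans _ (ltW fA))/ereal_sup_ubound; exists i.
have mupos : 0 < mu [set` i] by rewrite lt0e mu0 /=.
by rewrite -(lee_pmul2l muf mupos) muleA divee// mul1e muleC.
Qed.

(** Subadditivity suffices for joining the two halves, which share the point [x], a possible atom of
    [mu]. *)
Lemma ge0_integral_setU_le d (T : measurableType d) (R : realType)
    (m : {measure set T -> \bar R}) (A B : set T) (g : T -> \bar R) :
  measurable A -> measurable B -> measurable_fun (A `|` B) g ->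
  (forall y, 0 <= g y) ->
  \int[m]_(y in A `|` B) g y <= \int[m]_(y in A) g y + \int[m]_(y in B) g y.
Proof.
move=> mA mB mg g0.
have mBA : measurable (B `\` A) by exact: measurableD.
have E : A `|` B = A `|` (B `\` A) by rewrite setUDr setDv setD0.
rewrite E ge0_integral_setU -?E//; last by rewrite disj_set2E setDIK.
rewrite leeD2l// ge0_subset_integral//.
by apply: measurable_funS mg => //; exact: measurableU.
Qed.

(** Verifies the hypotheses of [one_sided_maximal_bound] for an actual variation measure, with [D]
    standing for either half. *)
Lemma half_line_maximal_bound (R : realType) (s x M1 M2 A : R) (a b : \bar R)
    (D : set R) (mu nu : {measure set (measurableTypeR R) -> \bar R})
    (k f : R -> R) :
  s != 0%R -> is_interval D -> D x -> D `<=` open_itv a b ->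
  (forall y, D y -> (s * x <= s * y)%R) ->
  is_variation_measure a b k nu ->
  \int[mu]_(y in open_itv a b) `|k y|%:E <= M1%:E ->
  \int[nu]_(y in D) mu (oseg s x y) <= M2%:E ->
  mu.-integrable setT (EFin \o f) -> noncentered_maximal mu f x < A%:E ->
  \int[mu]_(y in D) `|k y * f y|%:E <= ((2 * M1 + 3 * M2) * A)%:E.
Proof.
move=> s0 iD Dx Dab xD knu kM1 nuM2 intf fA.
have mk := locally_bounded_variation_measurable knu.1.
have mD : measurable (D : set (measurableTypeR R)).
  exact: is_interval_measurable.
have mab : measurable (open_itv a b : set (measurableTypeR R)).
  by apply: is_interval_measurable; exact: is_interval_open_itv.
apply: (one_sided_maximal_bound s0 iD Dx xD _ _ _ _ nuM2 intf).
- exact: measurable_funS mk.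
- move=> y z Dy Dz yz; rewrite oseg_itv//.
  have [ayz byz] := open_itv_minmax (Dab _ Dy) (Dab _ Dz).
  have mM : (Num.min y z <= Num.max y z)%R by rewrite ge_min !le_max lexx.
  apply: le_trans (variation_measure_itvcc knu ayz mM byz).1.
  apply: le_trans (total_variation_ge k mM).
  by case: (leP y z) => // _; rewrite distrC.
- move=> z Dz; rewrite oseg_itv ?xD//.
  have [ayz byz] := open_itv_minmax (Dab _ Dx) (Dab _ Dz).
  have mM : (Num.min x z <= Num.max x z)%R by rewrite ge_min !le_max lexx.
  exact: (variation_measure_itvcc knu ayz mM byz).2.
- apply: le_trans kM1; apply: ge0_subset_integral => //.
  by apply/measurable_EFinP; exact: measurableT_comp.
- by rewrite -lee_fin; apply: le_trans (ltW fA); exact: noncentered_maximal_ge0.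
move=> z Dz; rewrite oseg_itv ?xD//; apply: (integral_le_maximal intf fA).
by rewrite in_itv/= ge_min le_max !lexx.
Qed.

(* The interval between x and y whose measure is the weight in the second
   hypothesis is taken closed, and so is the range of integration at x.  This
   only matters when mu has atoms, and then the bound fails for open intervals:
   take x = 0, mu = N * dirac 1 + dirac 2, K(r, x, .) = \1_(]1, +oo[) and
   f = \1_[set 2]. *)
Theorem lemma3p1 (R : realType) (M1 M2 : R) :
  exists M : R,
  forall (a b : \bar R) (mu : {measure set (measurableTypeR R) -> \bar R})
    (P : Type) (K : P -> R -> R -> R)
    (nu : P -> R -> {measure set (measurableTypeR R) -> \bar R}),
  a < b ->
  mu (~` open_itv a b) = 0 ->
  (forall (r : P) (x : R), open_itv a b x ->
     is_variation_measure a b (K r x) (nu r x)) ->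
  (forall (r : P) (x : R), open_itv a b x ->
     \int[mu]_(y in open_itv a b) `|(K r x y)%:E| <= M1%:E) ->
  (forall (r : P) (x : R), open_itv a b x ->
     \int[nu r x]_(y in [set y : R | (x <= y)%R /\ y%:E < b])
        mu `[x, y]%classic <= M2%:E /\
     \int[nu r x]_(y in [set y : R | a < y%:E /\ (y <= x)%R])
        mu `[y, x]%classic <= M2%:E) ->
  forall (f : R -> R), mu.-integrable setT (EFin \o f) ->
  forall (r : P) (x : R), open_itv a b x ->
    `| \int[mu]_(y in open_itv a b) (K r x y * f y)%:E |
      <= M%:E * noncentered_maximal mu f x.
Proof.
(* Each half contributes [2 * M1 + 3 * M2]. The absolute values and the added 1 make the constant
   positive whatever [M1] and [M2] are; this is needed to divide by it and to multiply it by
   [+oo]. *)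
exists (2 * (2 * `|M1| + 3 * `|M2|) + 1)%R.
move=> a b mu P K nu _ _ Knu KM1 nuM2 f intf r x abx.
set M := (_ + 1)%R; pose C := (2 * (2 * M1 + 3 * M2))%R.
have {}Knu := Knu r x abx; have {}KM1 := KM1 r x abx.
have {nuM2}[nuR nuL] := nuM2 r x abx.
move: (K r x) (nu r x) Knu KM1 nuR nuL => k n kn kM1 nR nL.
have mk := locally_bounded_variation_measurable kn.1.
have [/measurable_EFinP mf _] := integrableP _ _ _ intf.
have E := open_itv_split abx; have [ax xb] := abx.
set DR := [set y | _ /\ y%:E < b] in E nR.
set DL := [set y | a < y%:E /\ _] in E nL.
have iR : is_interval DR.
  move=> u v [xu _] [_ vb] w /andP[uw wv]; split; first exact: le_trans uw.
  by apply: le_lt_trans vb; rewrite lee_fin.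
have iL : is_interval DL.
  move=> u v [au _] [_ vx] w /andP[uw wv]; split; last exact: le_trans vx.
  by apply: lt_le_trans au _; rewrite lee_fin.
have mab : measurable (open_itv a b : set (measurableTypeR R)).
  by apply: is_interval_measurable; exact: is_interval_open_itv.
have mkf : measurable_fun (open_itv a b : set (measurableTypeR R))
    (fun y => (k y * f y)%:E).
  apply/measurable_EFinP; apply: measurable_funM => //; exact: measurable_funTS.
have bound A : noncentered_maximal mu f x < A%:E ->
    `| \int[mu]_(y in open_itv a b) (k y * f y)%:E | <= (C * A)%:E.
  move=> fA; apply: le_trans (le_abse_integral mu mab mkf) _.
  apply: (@le_trans _ _ (\int[mu]_(y in DR) `|(k y * f y)%:E| +
                         \int[mu]_(y in DL) `|(k y * f y)%:E|)).
    rewrite E; apply: ge0_integral_setU_le => //.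
    - exact: is_interval_measurable.
    - exact: is_interval_measurable.
    - by rewrite -E; exact: measurableT_comp.
  have -> : (C * A = (2 * M1 + 3 * M2) * A + (2 * M1 + 3 * M2) * A)%R.
    by rewrite /C; ring.
  rewrite EFinD; apply: leeD.
    apply: (half_line_maximal_bound (s := 1%R) _ iR _ _ _ kn kM1 _ intf fA) => //.
    - by rewrite E; left.
    - by move=> y [xy _]; rewrite !mul1r.
    apply: le_trans nR; rewrite le_eqVlt; apply/orP; left; apply/eqP.
    apply: eq_integral => y; rewrite inE => -[xy _].
    by rewrite oseg_itv ?mul1r// (min_l xy) (max_r xy).
  apply: (half_line_maximal_bound (s := (-1)%R) _ iL _ _ _ kn kM1 _ intf fA) => //.
  - by rewrite E; right.
  - by move=> y [_ yx]; rewrite !mulN1r lerN2.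
  apply: le_trans nL; rewrite le_eqVlt; apply/orP; left; apply/eqP.
  apply: eq_integral => y; rewrite inE => -[_ yx].
  by rewrite oseg_itv ?oppr_eq0 ?mulN1r ?lerN2// (min_r yx) (max_l yx).
have M0 : (0 < M)%R by rewrite /M ltr_wpDl// ?mulr_ge0 ?addr_ge0 ?mulr_ge0.
have CM : (C <= M)%R.
  rewrite /C /M; have := ler_norm M1; have := ler_norm M2; lra.
have := noncentered_maximal_ge0 mu f x; move: bound.
case: (noncentered_maximal mu f x) => [m| |//] bound m0; last first.
  by rewrite gt0_muley ?leey ?lte_fin.
(* The strict bound is applied at [A = m + e / M], which exceeds the finite value [m] of the maximal
   function and costs only [e] after multiplication by [M]. *)
apply/lee_addgt0Pr => e e0.
apply: le_trans (bound (m + e / M)%R _) _.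
  by rewrite lte_fin ltrDl divr_gt0.
rewrite -EFinM -EFinD lee_fin.
rewrite (_ : M * m + e = M * (m + e / M))%R; last first.
  by rewrite mulrDr mulrCA divff ?mulr1// gt_eqF.
by rewrite ler_wpM2r// addr_ge0// divr_ge0// ltW.
Qed.
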